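(* Let $\phi_c(t)=\mathbb I(0\le t\le1/\beta)$ and $\phi_c'(t)=\mathbb I(0\le t\le1/\alpha)$ be the CVaR divergences with parameters $\beta,\alpha\in(0,1)$, where $K_2=n_-\beta$ and $K_1=n_+\alpha$ are (positive) integers. If $\ell(\cdot)$ is monotonically decreasing where $\ell(\cdot)>0$, then for every $\mathbf w$ $$F(\mathbf w;\phi_c,\phi_c')=\frac1{K_1K_2}\sum_{\mathbf x_i\in\mathcal S_+^{\uparrow}[1,K_1]}\ \sum_{\mathbf x_j\in\mathcal S_-^{\downarrow}[1,K_2]}L(\mathbf w;\mathbf x_i,\mathbf x_j),$$ which is also equal to $$F(\mathbf w;\phi_c,\phi_c')=\min_{s'\in\mathbb R,\ \mathbf s\in\mathbb R^{n_+}}\ s'+\frac1{n_+\alpha}\sum_{\mathbf x_i\in\mathcal S_+}\Big(s_i+\frac1\beta\psi_i(\mathbf w;s_i)-s'\Big)_+ .$$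
   Context: $\mathcal S_+$, $\mathcal S_-$ are finite sets of positive and negative examples, $n_\pm=|\mathcal S_\pm|$. $h_{\mathbf w}(\mathbf x)\in\mathbb R$ is a score function with parameter $\mathbf w\in\mathbb R^d$, and $L(\mathbf w;\mathbf x_i,\mathbf x_j)=\ell(h_{\mathbf w}(\mathbf x_i)-h_{\mathbf w}(\mathbf x_j))$. Standing assumption on $\ell:\mathbb R\to\mathbb R$: it is convex, differentiable, monotonically decreasing where $\ell(\cdot)>0$, and $\ell'(0)<0$. $\psi_i(\mathbf w;s_i)=\frac1{n_-}\sum_{\mathbf x_j\in\mathcal S_-}(L(\mathbf w;\mathbf x_i,\mathbf x_j)-s_i)_+$, with $(s)_+=\max(s,0)$. $\mathcal S_-^{\downarrow}[1,K]$ denotes the $K$ negative examples with largest scores $h_{\mathbf w}$, and $\mathcal S_+^{\uparrow}[1,K]$ the $K$ positive examples with smallest scores (ties broken arbitrarily). For divergences $\phi,\phi'$ and $\lambda,\lambda'>0$, $$\hat L_\phi(\mathbf x_i,\mathbf w)=\max_{\mathbf p\in\Delta}\sum_{\mathbf x_j\in\mathcal S_-}p_jL(\mathbf w;\mathbf x_i,\mathbf x_j)-\lambda D_\phi(\mathbf p,1/n_-),\qquad F(\mathbf w;\phi,\phi')=\max_{\mathbf p\in\Delta}\sum_{\mathbf x_i\in\mathcal S_+}p_i\hat L_\phi(\mathbf x_i,\mathbf w)-\lambda'D_{\phi'}(\mathbf p,1/n_+),$$ where $\Delta$ is the probability simplex of the appropriate dimension. For a CVaR divergence with parameter $\gamma$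 on $n$ points, $D(\mathbf p,1/n)=0$ if $p_i\le1/(n\gamma)$ for all $i$, and $+\infty$ otherwise. *)

(* Defs.v *)
From HB Require Import structures.
From mathcomp Require Import all_boot all_order all_algebra.
From mathcomp Require Import finmap.
From mathcomp Require Import all_classical all_reals all_analysis.

Set Implicit Arguments.
Unset Strict Implicit.
Unset Printing Implicit Defensive.

Import Order.TTheory GRing.Theory Num.Theory.
Import numFieldNormedType.Exports.

Local Open Scope fset_scope.
Local Open Scope classical_set_scope.
Local Open Scope ring_scope.

Definition is_max (R : realType) (T : Type) (A : set T) (f : T -> \bar R)
    (v : \bar R) : Prop :=
  (exists2 x, A x & f x = v) /\ (forall x, A x -> (f x <= v)%E).

Definition is_min (R : realType) (T : Type) (A : set T) (f : T -> \bar R)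
    (v : \bar R) : Prop :=
  (exists2 x, A x & f x = v) /\ (forall x, A x -> (v <= f x)%E).

Definition simplex (R : realType) (I : finType) : set (I -> R) :=
  [set p | (forall i, 0 <= p i) /\ \sum_i p i = 1].

Arguments simplex : clear implicits.

Definition unif (R : realType) (I : finType) : I -> R := fun=> #|I|%:R^-1.

Arguments unif : clear implicits.

Definition phi_div (R : realType) (I : finType) (phi : R -> \bar R)
    (p q : I -> R) : \bar R :=
  (\sum_i (q i)%:E * phi (p i / q i)%R)%E.

(* The indicator is the one of convex analysis: 0 where the condition holds,
   +oo elsewhere. *)
Definition cvar_phi (R : realType) (gamma : R) (t : R) : \bar R :=
  if 0 <= t <= gamma^-1 then 0%E else +oo%E.

Lemma phi_div_cvarE (R : realType) (I : finType) (gamma : R) (p : I -> R) :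
  0 < gamma -> p \in simplex R I ->
  phi_div (cvar_phi gamma) p (unif R I) =
  if [forall i, p i <= (#|I|%:R * gamma)^-1] then 0%E else +oo%E.
Proof.
move=> g0; rewrite inE => -[p0 _].
have n0 (i : I) : (0 : R) < #|I|%:R by rewrite ltr0n; apply/card_gt0P; exists i.
have phiE i : cvar_phi gamma (p i / unif R I i) =
    if p i <= (#|I|%:R * gamma)^-1 then 0%E else +oo%E.
  rewrite /cvar_phi /unif invrK mulr_ge0 ?ler0n//=.
  by rewrite invfM ler_pdivlMl ?n0// mulrC.
have phi0 i : (0 <= (unif R I i)%:E * cvar_phi gamma (p i / unif R I i)%R)%E.
  apply: mule_ge0; first by rewrite lee_fin invr_ge0.
  by rewrite phiE; case: ifP.
case: ifPn => [/forallP pi|].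
  by rewrite /phi_div big1// => i _; rewrite phiE pi mule0.
rewrite negb_forall => /existsP[i pi].
have u0 : (0 < (unif R I i)%:E)%E by rewrite lte_fin invr_gt0 n0.
rewrite /phi_div (bigD1 i)//= phiE (negbTE pi) gt0_muley//.
rewrite addye// gt_eqF// (@lt_le_trans _ _ 0%E)//.
by apply: sume_ge0 => j _; exact: phi0.
Qed.

Definition pair_loss (R : realType) (d : nat) (X : choiceType) (l : R -> R)
    (h : 'rV[R]_d -> X -> R) (w : 'rV[R]_d) (xi xj : X) : R :=
  l (h w xi - h w xj).

Definition Lhat_obj (R : realType) (d : nat) (X : choiceType) (l : R -> R)
    (h : 'rV[R]_d -> X -> R) (Sm : {fset X}) (lam : R) (phi : R -> \bar R)
    (w : 'rV[R]_d) (xi : X) (p : Sm -> R) : \bar R :=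
  ((\sum_(j : Sm) p j * pair_loss l h w xi (val j))%R%:E
   - lam%:E * phi_div phi p (unif R Sm))%E.

Definition Lhat (R : realType) (d : nat) (X : choiceType) (l : R -> R)
    (h : 'rV[R]_d -> X -> R) (Sm : {fset X}) (lam : R) (phi : R -> \bar R)
    (w : 'rV[R]_d) (xi : X) : \bar R :=
  ereal_sup (@Lhat_obj R d X l h Sm lam phi w xi @` simplex R Sm).

Definition F_obj (R : realType) (d : nat) (X : choiceType) (l : R -> R)
    (h : 'rV[R]_d -> X -> R) (Sp Sm : {fset X}) (lam lam' : R)
    (phi phi' : R -> \bar R) (w : 'rV[R]_d) (p : Sp -> R) : \bar R :=
  (\sum_(i : Sp) (p i)%:E * Lhat l h Sm lam phi w (val i)
   - lam'%:E * phi_div phi' p (unif R Sp))%E.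

Definition F (R : realType) (d : nat) (X : choiceType) (l : R -> R)
    (h : 'rV[R]_d -> X -> R) (Sp Sm : {fset X}) (lam lam' : R)
    (phi phi' : R -> \bar R) (w : 'rV[R]_d) : \bar R :=
  ereal_sup (@F_obj R d X l h Sp Sm lam lam' phi phi' w @` simplex R Sp).

Definition psi (R : realType) (d : nat) (X : choiceType) (l : R -> R)
    (h : 'rV[R]_d -> X -> R) (Sm : {fset X}) (w : 'rV[R]_d) (xi : X)
    (si : R) : R :=
  #|` Sm|%:R^-1 *
  \sum_(j : Sm) Num.max (pair_loss l h w xi (val j) - si) 0.

(* With ties, several sets satisfy [top_scores] (resp. [bottom_scores]);
   every tie-breaking rule selects one of them. *)
Definition top_scores (R : realType) (X : choiceType) (score : X -> R)
    (S : {fset X}) (K : nat) (B : {fset X}) : Prop :=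
  [/\ (B `<=` S)%fset, #|` B| = K &
      forall x y, x \in B -> y \in S -> y \notin B -> score y <= score x].

Definition bottom_scores (R : realType) (X : choiceType) (score : X -> R)
    (S : {fset X}) (K : nat) (A : {fset X}) : Prop :=
  [/\ (A `<=` S)%fset, #|` A| = K &
      forall x y, x \in A -> y \in S -> y \notin A -> score x <= score y].

Definition min_obj (R : realType) (d : nat) (X : choiceType) (l : R -> R)
    (h : 'rV[R]_d -> X -> R) (Sp Sm : {fset X}) (alpha beta : R)
    (w : 'rV[R]_d) (s : R * (Sp -> R)) : R :=
  s.1 + (#|` Sp|%:R * alpha)^-1 *
    \sum_(i : Sp)
      Num.max (s.2 i + beta^-1 * psi l h Sm w (val i) (s.2 i) - s.1) 0.

(* Main.v *)
Require Import Defs.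
From HB Require Import structures.
From mathcomp Require Import all_boot all_order all_algebra.
From mathcomp Require Import finmap.
From mathcomp Require Import all_classical all_reals all_analysis.
From mathcomp Require Import ring lra.

Set Implicit Arguments.
Unset Strict Implicit.
Unset Printing Implicit Defensive.

Import Order.TTheory GRing.Theory Num.Theory.
Import numFieldNormedType.Exports.

Local Open Scope fset_scope.
Local Open Scope classical_set_scope.
Local Open Scope ring_scope.

(* On n points with gamma n = K, the CVaR-constrained weights are those bounded
   by 1/K, so maximizing a linear form over them yields the mean of its K largest
   coefficients; by weak duality this is also the minimum over s of
   s + (1/K) sum_i (v_i - s)_+, attained at the K-th largest value.  A convex
   loss that decreases where it is positive is nonincreasing on the whole line,
   so the largest losses for a positive example are those of the top-scored
   negatives, the same for all positives, and the inner maximum is nonincreasing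
   in the positive score.  Applying the one-level result twice, with monotonicity
   of the outer dual in its values, gives both formulas. *)

Definition topset (R : realType) (I : finType) (v : I -> R) (T : {set I}) : Prop :=
  forall i j, i \in T -> j \notin T -> v j <= v i.

Definition topmean (R : realType) (I : finType) (v : I -> R) (T : {set I}) : R :=
  #|T|%:R^-1 * \sum_(i in T) v i.

Definition cvar_dual (R : realType) (I : finType) (K : nat) (v : I -> R) (s : R) : R :=
  s + K%:R^-1 * \sum_i Num.max (v i - s) 0.

(** Greedy construction: a top set grows by a maximizer of [v] over its complement. *)
Lemma topset_exists (R : realType) (I : finType) (v : I -> R) (K : nat) :
  (K <= #|I|)%N -> exists2 T : {set I}, #|T| = K & topset v T.
Proof.
elim: K => [_|K IH ltKI].
  by exists finset.set0; [exact: cards0|move=> i j; rewrite finset.in_set0].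
have [T TK topT] := IH (ltnW ltKI).
have /set0Pn[i0] : ~: T != finset.set0.
  by rewrite -card_gt0 cardsCs finset.setCK subn_gt0 TK.
rewrite finset.in_setC => i0T.
case: (arg_maxP (P := [pred i | i \notin T]) v i0T) => i /= iT imax; exists (i |: T)%SET.
  by rewrite cardsU1 TK iT.
move=> k j; rewrite !finset.in_setU1 negb_or => /orP[/eqP->|kT] /andP[_ jT].
  exact: imax.
exact: topT.
Qed.

(** Since the weights sum to 1, [s] splits off; then [0 <= p i] allows passing to the positive part
    of [v i - s], and [p i <= K^-1] replaces the weight. *)
Lemma cvar_weak_duality (R : realType) (I : finType) (K : nat) (v p : I -> R) (s : R) :
  simplex R I p -> (forall i, p i <= K%:R^-1) ->
  \sum_i p i * v i <= cvar_dual K v s.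
Proof.
move=> [p0 p1] pK; rewrite /cvar_dual.
have -> : \sum_i p i * v i = s + \sum_i p i * (v i - s).
  rewrite -[X in X + _]mul1r -p1 mulr_suml -big_split/=.
  by apply: eq_bigr => i _; rewrite -mulrDr addrC subrK.
rewrite lerD2l mulr_sumr ler_sum// => i _.
apply: (@le_trans _ _ (p i * Num.max (v i - s) 0)).
  by rewrite ler_wpM2l// le_max lexx.
by rewrite ler_wpM2r// le_max lexx orbT.
Qed.

Lemma topmean_dual (R : realType) (I : finType) (v : I -> R) (T : {set I}) :
  (0 < #|T|)%N -> topset v T -> exists s, cvar_dual #|T| v s = topmean v T.
Proof.
move=> T0 topT; have /card_gt0P[i0 i0T] := T0.
(* The optimal [s] is the least value of [v] on [T]: outside [T] the positive parts vanish, inside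
   they are [v i - s], and the copies of [s] cancel. *)
case: (arg_minP v i0T) => i iT imin; exists (v i).
have TR : #|T|%:R != 0 :> R by rewrite pnatr_eq0 -lt0n.
rewrite /cvar_dual /topmean (bigID (mem T))/= [X in _ * (_ + X)]big1 ?addr0; last first.
  by move=> j jT; apply/max_idPr; rewrite subr_le0; exact: topT.
rewrite (eq_bigr (fun j => v j - v i)); last first.
  by move=> j jT; apply/max_idPl; rewrite subr_ge0; exact: imin.
rewrite sumrB sumr_const mulrBr -[v i *+ _]mulr_natl mulKf//.
by rewrite addrC subrK.
Qed.

(** The uniform distribution on [T], a primal optimizer when [T] is a top set. *)
Definition top_weights (R : realType) (I : finType) (T : {set I}) (i : I) : R :=
  if i \in T then #|T|%:R^-1 else 0.

Lemma sum_top_weights (R : realType) (I : finType) (v : I -> R) (T : {set I}) :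
  \sum_i top_weights R T i * v i = topmean v T.
Proof.
rewrite /topmean mulr_sumr [RHS]big_mkcond/=; apply: eq_bigr => i _.
by rewrite /top_weights; case: ifP => // _; rewrite mul0r.
Qed.

Lemma top_weights_simplex (R : realType) (I : finType) (T : {set I}) :
  (0 < #|T|)%N -> simplex R I (top_weights R T).
Proof.
move=> T0; split=> [i|].
  by rewrite /top_weights; case: ifP => //; rewrite invr_ge0.
transitivity (topmean (fun=> 1 : R) T).
  by rewrite -sum_top_weights; apply: eq_bigr => i _; rewrite mulr1.
by rewrite /topmean sumr_const mulVf// pnatr_eq0 -lt0n.
Qed.

Lemma topmean_le_dual (R : realType) (I : finType) (v : I -> R) (T : {set I}) (s : R) :
  (0 < #|T|)%N -> topmean v T <= cvar_dual #|T| v s.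
Proof.
move=> T0; rewrite -sum_top_weights; apply: cvar_weak_duality.
  exact: top_weights_simplex.
by move=> i; rewrite /top_weights; case: ifP => //; rewrite invr_ge0.
Qed.

Lemma cvar_is_max (R : realType) (I : finType) (v : I -> R) (T : {set I})
    (lam gamma : R) :
  0 < lam -> 0 < gamma -> (0 < #|T|)%N -> topset v T ->
  #|T|%:R = #|I|%:R * gamma ->
  is_max (simplex R I)
    (fun p => ((\sum_i p i * v i)%R%:E
               - lam%:E * phi_div (cvar_phi gamma) p (unif R I))%E)
    (topmean v T)%:E.
Proof.
move=> lam0 g0 T0 topT TE; split.
  exists (top_weights R T); first exact: top_weights_simplex.
  rewrite phi_div_cvarE//; last by rewrite inE; exact: top_weights_simplex.
  rewrite -TE ifT ?mule0 ?sube0 ?sum_top_weights//.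
  by apply/forallP => i; rewrite /top_weights; case: ifP => //; rewrite invr_ge0.
move=> p pS; rewrite phi_div_cvarE//; last by rewrite inE.
(* A [p] that violates the cap has objective [-oo], because [lam > 0]. *)
case: ifPn => [/forallP pK|_]; last first.
  by rewrite gt0_muley ?lte_fin//= leNye.
rewrite mule0 sube0 lee_fin.
have [s <-] := topmean_dual T0 topT.
by apply: cvar_weak_duality => // i; rewrite TE.
Qed.

Lemma is_max_ereal_sup (R : realType) (T : Type) (A : set T) (f : T -> \bar R) v :
  is_max A f v -> ereal_sup (f @` A) = v.
Proof.
move=> [[x Ax fx] ub]; apply/eqP; rewrite eq_le; apply/andP; split.
  by apply: ge_ereal_sup => _ [y Ay <-]; exact: ub.
by apply: ereal_sup_ubound; exists x.
Qed.

(** The point [b] is the convex combination of [a + t * (b - a)] and [a] with weights [t^-1] and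
    [1 - t^-1]; the convexity inequality is multiplied by [t]. *)
Lemma convex_extrapolation (R : realType) (f : R -> R) (a b t : R) :
  convex_function (E := R^o) [set: R^o] f -> 1 <= t ->
  f a + t * (f b - f a) <= f (a + t * (b - a)).
Proof.
move=> fconv t1; have t0 : 0 < t by exact: lt_le_trans t1.
have ti : 0 <= t^-1 <= 1 by rewrite invr_ge0 ltW//= invf_le1.
pose u : {i01 R} := Itv01 (proj1 (andP ti)) (proj2 (andP ti)).
have convE (x y : R) : conv u (x : R^o) (y : R^o) = t^-1 * x + (1 - t^-1) * y.
  by rewrite convRE.
have fu x y : f (conv u (x : R^o) (y : R^o)) <= conv u (f x : R^o) (f y : R^o).
  by apply: fconv; rewrite inE.
have := fu (a + t * (b - a)) a; rewrite !convE.
rewrite (_ : t^-1 * (a + _) + _ = b); last by field; rewrite gt_eqF.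
set y := f (a + _); rewrite -(ler_pM2l t0).
rewrite (_ : t * (t^-1 * y + _) = y + (t - 1) * f a); last by field; rewrite gt_eqF.
lra.
Qed.

Lemma convex_nonincreasing (R : realType) (f : R -> R) :
  convex_function (E := R^o) [set: R^o] f ->
  (forall s t, 0 < f s -> 0 < f t -> s <= t -> f t <= f s) ->
  {homo f : x y / x <= y >-> y <= x}.
Proof.
move=> fconv fdecr a b; rewrite le_eqVlt => /orP[/eqP->//|ab].
rewrite leNgt; apply/negP => fab.
(* If f a < f b, extrapolating from a gives a point c with f c > 0 and then a
   point e > c with f e > f c. *)
pose d := f b - f a; have d0 : 0 < d by rewrite subr_gt0.
(* Chosen so that [t * d] is [|f a| + d], which forces [f c >= d > 0]. *)
pose t := `|f a| / d + 1.
have t1 : 1 <= t by rewrite lerDr divr_ge0// ltW.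
pose c := a + t * (b - a).
have ac : a < c by rewrite ltrDl mulr_gt0 ?subr_gt0// (lt_le_trans _ t1).
have fc : f a + `|f a| + d <= f c.
  have := convex_extrapolation a b fconv t1.
  by rewrite -/d -/c {1}/t mulrDl mul1r divfK ?gt_eqF// addrA.
have fca : f a < f c by apply: lt_le_trans fc; rewrite -addrA ltrDl ltr_wpDl.
have fc0 : 0 < f c.
  by apply: lt_le_trans fc; have := ler_norm (- f a); rewrite normrN; lra.
have t2 : 1 <= 2 :> R by rewrite ler1n.
have := convex_extrapolation a c fconv t2.
set e := a + _ => fe.
have fce : f c < f e by apply: lt_le_trans fe; lra.
have ce : c <= e by rewrite /e; lra.
by have := fdecr c e fc0 (lt_trans fc0 fce) ce; rewrite leNgt fce.
Qed.

(** Passes from sums over subsets of [X] to sums over subsets of the finite type [S], where top sets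
    live. *)
Lemma sum_fsub (R : realType) (X : choiceType) (S A : {fset X}) (f : X -> R) :
  (A `<=` S)%fset -> \sum_(x <- A) f x = \sum_(i in fsub S A) f (val i).
Proof.
move=> AS; rewrite [RHS]big_mkcond/=.
under [RHS]eq_bigr do rewrite in_fsub.
rewrite -(big_seq_fsetE _ S xpredT (fun x => if x \in A then f x else 0))/=.
rewrite -(big_fset_incl _ AS); last by move=> x _ /negbTE->.
by rewrite big_seq [RHS]big_seq; apply: eq_bigr => x ->.
Qed.

Theorem lemma7 (R : realType) (d : nat) (X : choiceType)
  (l : R -> R) (h : 'rV[R]_d -> X -> R) (Sp Sm : {fset X})
  (lam lam' alpha beta : R) (K1 K2 : nat)
  (l_convex : convex_function (E := R^o) [set: R^o] l)
  (l_diff : forall t : R, derivable l t 1)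
  (l_decr : forall s t : R, 0 < l s -> 0 < l t -> s <= t -> l t <= l s)
  (l_deriv0 : derive1 l 0 < 0)
  (lam_gt0 : 0 < lam) (lam'_gt0 : 0 < lam')
  (alpha01 : 0 < alpha < 1) (beta01 : 0 < beta < 1)
  (K1_gt0 : (0 < K1)%N) (K2_gt0 : (0 < K2)%N)
  (K1E : K1%:R = #|` Sp|%:R * alpha) (K2E : K2%:R = #|` Sm|%:R * beta)
  (w : 'rV[R]_d) :
  let phi := cvar_phi beta in
  let phi' := cvar_phi alpha in
  let Fw := F l h Sp Sm lam lam' phi phi' w in
  [/\ (* the suprema defining Lhat and F are maxima *)
      forall xi, xi \in Sp ->
        is_max (simplex R Sm) (@Lhat_obj R d X l h Sm lam phi w xi)
               (Lhat l h Sm lam phi w xi),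
      is_max (simplex R Sp) (@F_obj R d X l h Sp Sm lam lam' phi phi' w) Fw,
      forall A B : {fset X},
        bottom_scores (h w) Sp K1 A -> top_scores (h w) Sm K2 B ->
        Fw = ((K1%:R * K2%:R)^-1 *
              \sum_(xi <- A) \sum_(xj <- B) pair_loss l h w xi xj)%:E
    & is_min [set: R * (Sp -> R)]
             (fun s => (min_obj l h Sm alpha beta w s)%:E) Fw].
Proof.
move=> phi phi' Fw.
have [a0 a1] := andP alpha01; have [b0 b1] := andP beta01.
have lnoninc := convex_nonincreasing l_convex l_decr.
have card_le (S : {fset X}) (g : R) K : g < 1 -> K%:R = #|` S|%:R * g -> (K <= #|{: S}|)%N.
  move=> g1 KE; rewrite -(ler_nat R) KE -cardfE.
  by rewrite -[leRHS]mulr1 ler_wpM2l// ltW.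
have K1le := card_le _ _ _ a1 K1E; have K2le := card_le _ _ _ b1 K2E.
pose L xi (j : Sm) := pair_loss l h w xi (val j).
have Lhat_max xi (T : {set Sm}) : #|T| = K2 -> topset (L xi) T ->
    is_max (simplex R Sm) (@Lhat_obj R d X l h Sm lam phi w xi)
           (topmean (L xi) T)%:E.
  move=> TK topT; apply: cvar_is_max => //; first by rewrite TK.
  by rewrite TK K2E cardfE.
(* All top sets of size [K2] give the same mean, since each mean equals the inner maximum; [c xi] is
   this finite value. *)
have [c cE] : exists c : X -> R, forall xi (T : {set Sm}), #|T| = K2 ->
    topset (L xi) T -> topmean (L xi) T = c xi.
  exists (fun xi => fine (Lhat l h Sm lam phi w xi)) => xi T TK topT.
  by rewrite /Lhat (is_max_ereal_sup (Lhat_max xi T TK topT)).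
have LhatE xi : Lhat l h Sm lam phi w xi = (c xi)%:E.
  have [T TK topT] := topset_exists (L xi) K2le.
  by rewrite /Lhat (is_max_ereal_sup (Lhat_max xi T TK topT)) (cE xi T).
pose cp (i : Sp) := c (val i).
have F_max (T : {set Sp}) : #|T| = K1 -> topset cp T ->
    is_max (simplex R Sp) (@F_obj R d X l h Sp Sm lam lam' phi phi' w)
           (topmean cp T)%:E.
  move=> TK topT.
  have -> : @F_obj R d X l h Sp Sm lam lam' phi phi' w =
      fun p => ((\sum_i p i * cp i)%R%:E
                - lam'%:E * phi_div phi' p (unif R Sp))%E.
    apply/funext => p; rewrite /F_obj -sumEFin; congr (_ - _)%E.
    by apply: eq_bigr => i _; rewrite LhatE EFinM.
  apply: cvar_is_max => //; first by rewrite TK.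
  by rewrite TK K1E cardfE.
have FE (T : {set Sp}) : #|T| = K1 -> topset cp T -> Fw = (topmean cp T)%:E.
  by move=> TK topT; exact: is_max_ereal_sup (F_max T TK topT).
have [TP TPK topTP] := topset_exists cp K1le.
split.
- move=> xi _; have [T TK topT] := topset_exists (L xi) K2le.
  by rewrite LhatE -(cE xi T)//; exact: Lhat_max.
- by rewrite (FE TP)//; exact: F_max.
- move=> A B [AS AK botA] [BS BK topB].
  (* A higher negative score lowers the argument of [l], so the single set [B] is a top set of
     losses for every [xi]. *)
  have cB xi : c xi = K2%:R^-1 * \sum_(xj <- B) pair_loss l h w xi xj.
    rewrite -(cE xi (fsub Sm B)) ?card_fsub//.
      by rewrite /topmean card_fsub// BK (sum_fsub _ BS).
    move=> i j; rewrite !in_fsub => iB jB; apply: lnoninc.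
    by rewrite lerD2l lerN2 topB// (valP j).
  rewrite (FE (fsub Sp A)) ?card_fsub//.
    rewrite /topmean card_fsub// AK -(sum_fsub c AS).
    under eq_bigr do rewrite cB.
    by rewrite -mulr_sumr mulrA -invfM.
  (* With [B] fixed, each loss is nonincreasing in the positive score, so [A] is a top set for
     [cp]. *)
  move=> i j; rewrite !in_fsub => iA jA; rewrite /cp !cB.
  rewrite ler_wpM2l ?invr_ge0// ler_sum// => xj _; apply: lnoninc.
  by rewrite lerD2r botA// (valP j).
have K2n : K2%:R^-1 = beta^-1 * #|` Sm|%:R^-1 by rewrite K2E invfM mulrC.
have min_objE (s : R * (Sp -> R)) : min_obj l h Sm alpha beta w s = cvar_dual K1
    (fun i => cvar_dual K2 (L (val i)) (s.2 i)) s.1.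
  rewrite /min_obj /cvar_dual -K1E; congr (_ + _ * _).
  by apply: eq_bigr => i _; rewrite /psi mulrA -K2n.
rewrite (FE TP)//; split.
  have [s' s'E] := topmean_dual (v := cp) (T := TP) ltac:(by rewrite TPK) topTP.
  (* An optimal inner [s i] for each positive example turns the inner duals into [cp], for which
     [s'] is optimal. *)
  have /choice[s sE] (i : Sp) : exists s, cvar_dual K2 (L (val i)) s = cp i.
    have [T TK topT] := topset_exists (L (val i)) K2le.
    rewrite /cp -(cE _ T)// -TK; apply: topmean_dual => //; by rewrite TK.
  exists (s', s) => //; rewrite min_objE -s'E TPK.
  by congr EFin; rewrite (_ : (fun i => _) = cp)//; apply/funext => i; exact: sE.
move=> s _; rewrite lee_fin min_objE.
(* Lower bound: outer weak duality for [cp], then each [cp i] is replaced by its inner dual, which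
   is at least as large. *)
have : topmean cp TP <= cvar_dual K1 cp s.1.
  by rewrite -TPK; apply: topmean_le_dual; rewrite TPK.
move=> /le_trans; apply; rewrite /cvar_dual lerD2l ler_wpM2l ?invr_ge0//.
apply: ler_sum => i _; apply: le_max2 => //; rewrite lerD2r.
have [T TK topT] := topset_exists (L (val i)) K2le.
by rewrite /cp -(cE _ T)// -TK topmean_le_dual// TK.
Qed.
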